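(* Suppose there are Banach spaces $X, Y$ and a non-expansive bijection $f\colon B_X \to B_Y$ such that $f$ is not an isometry. Then there is a Banach space $Z$ and a non-expansive bijection $f'\colon B_Z \to B_Z$ such that $f'$ is not an isometry.
   Context: For a Banach space $X$, $B_X$ denotes its closed unit ball. A map $f$ between metric spaces is non-expansive if it is 1-Lipschitz, i.e. $d(f(x),f(y)) \le d(x,y)$ for all $x,y$. *)

(* Defs.v *)
From HB Require Import structures.
From mathcomp Require Import all_boot all_order all_algebra.
From mathcomp Require Import all_classical all_reals all_analysis.

Set Implicit Arguments.
Unset Strict Implicit.
Unset Printing Implicit Defensive.

Import Order.TTheory GRing.Theory Num.Theory.
Import numFieldNormedType.Exports.

Local Open Scope classical_set_scope.
Local Open Scope ring_scope.

Definition unit_ball (R : realType) (X : normedModType R) : set X :=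
  [set x | `|x| <= 1].
Arguments unit_ball {R} X.

Lemma unit_ballE (R : realType) (X : normedModType R) :
  unit_ball X = closed_ball (0 : X) 1.
Proof.
by rewrite closed_ballE// /closed_ball_; apply/seteqP; split => x /=;
  rewrite /unit_ball /= sub0r normrN.
Qed.

(* A map B_X -> B_Y is encoded as a total function X -> Y of which only the
   values on the unit ball of X matter. *)
Definition nonexpansive_on (R : realType) (X Y : normedModType R)
    (A : set X) (f : X -> Y) : Prop :=
  1.-lipschitz_A f.

Lemma nonexpansive_onP (R : realType) (X Y : normedModType R)
    (A : set X) (f : X -> Y) :
  nonexpansive_on A f <->
  (forall x y, A x -> A y -> `|f x - f y| <= `|x - y|).
Proof.
split=> [fA x y Ax Ay|fA [x y] [/= Ax Ay]]; last by rewrite mul1r; exact: fA.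
by have := fA (x, y) (conj Ax Ay); rewrite /= mul1r.
Qed.

Definition isometry_on (R : realType) (X Y : normedModType R)
    (A : set X) (f : X -> Y) : Prop :=
  forall x y, A x -> A y -> `|f x - f y| = `|x - y|.

(* Main.v *)
Require Import Defs.
From HB Require Import structures.
From mathcomp Require Import all_boot all_order all_algebra.
From mathcomp Require Import all_classical all_reals all_analysis.

Set Implicit Arguments.
Unset Strict Implicit.
Unset Printing Implicit Defensive.

Import Order.TTheory GRing.Theory Num.Theory.
Import numFieldNormedType.Exports.

Local Open Scope classical_set_scope.
Local Open Scope ring_scope.

(** If [X] and [Y] could be chosen equal there would be nothing to do; the
    idea is to make them equal by putting infinitely many copies of both in a
    row.  Let [Z] be the space of bounded families indexed by the integers
    whose coordinates of negative index lie in [X] and whose other coordinates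
    lie in [Y], with the supremum norm.  The unit ball of [Z] is the product
      ... x B_X x B_X x B_Y x B_Y x ...
    and the shift by one place to the right, which is the identity from one
    copy to the next except for the single crossing from [X] (index -1) to [Y]
    (index 0), where it applies [f], is a map from this product to itself.
    Since everything happens coordinatewise and the norm is a supremum, the
    shift is bijective and non-expansive because [f] and the identity are; and
    as the families supported at index -1 form an isometric copy of [X] on
    which the shift acts as [f], it is an isometry only if [f] is.

    The passage between the norm of [Z] and the norms of the coordinates is
    [linf_normP].  The one analytic point is the completeness of [Z]
    ([linf_cauchy_cvg]), the usual proof that a uniformly Cauchy filter
    converges uniformly. *)

(** * The supremum sum of a family of Banach spaces *)

Section LinfSum.
Context {R : realType} {I : Type} (T : I -> completeNormedModType R).

Record linf := Linf {
  linf_coord :> forall i, T i;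
  linf_bounded : exists M, forall i, `|linf_coord i| <= M }.

Lemma linf_ext (x y : linf) : (forall i, x i = y i) -> x = y.
Proof.
case: x y => [x bx] [y by_] /= xy.
have exy : x = y by apply: functional_extensionality_dep.
by subst y; congr Linf; exact: Prop_irrelevance.
Qed.

HB.instance Definition _ := gen_eqMixin linf.
HB.instance Definition _ := gen_choiceMixin linf.

Lemma linf0_subproof : exists M, forall i, `|0 : T i| <= M.
Proof. by exists 0 => i; rewrite normr0. Qed.

Lemma linfN_subproof (x : linf) : exists M, forall i, `|- x i| <= M.
Proof.
by have [M xM] := linf_bounded x; exists M => i; rewrite normrN.
Qed.

Lemma linfD_subproof (x y : linf) : exists M, forall i, `|x i + y i| <= M.
Proof.
have [M xM] := linf_bounded x; have [N yN] := linf_bounded y.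
by exists (M + N) => i; rewrite (le_trans (ler_normD _ _))// lerD.
Qed.

Lemma linfZ_subproof (a : R) (x : linf) : exists M, forall i, `|a *: x i| <= M.
Proof.
have [M xM] := linf_bounded x.
by exists (`|a| * M) => i; rewrite normrZ ler_wpM2l ?xM.
Qed.

Definition linf0 := Linf linf0_subproof.
Definition linfN x := Linf (linfN_subproof x).
Definition linfD x y := Linf (linfD_subproof x y).
Definition linfZ a x := Linf (linfZ_subproof a x).

Lemma linfDA : associative linfD.
Proof. by move=> x y z; apply: linf_ext => i /=; rewrite addrA. Qed.

Lemma linfDC : commutative linfD.
Proof. by move=> x y; apply: linf_ext => i /=; rewrite addrC. Qed.

Lemma linfD0 : left_id linf0 linfD.
Proof. by move=> x; apply: linf_ext => i /=; rewrite add0r. Qed.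

Lemma linfDN : left_inverse linf0 linfN linfD.
Proof. by move=> x; apply: linf_ext => i /=; rewrite addNr. Qed.

HB.instance Definition _ := GRing.isZmodule.Build linf
  linfDA linfDC linfD0 linfDN.

Lemma linfZA a b x : linfZ a (linfZ b x) = linfZ (a * b) x.
Proof. by apply: linf_ext => i /=; rewrite scalerA. Qed.

Lemma linfZ1 : left_id 1 linfZ.
Proof. by move=> x; apply: linf_ext => i /=; rewrite scale1r. Qed.

Lemma linfZDr : right_distributive linfZ +%R.
Proof. by move=> a x y; apply: linf_ext => i /=; rewrite scalerDr. Qed.

Lemma linfZDl x : {morph linfZ^~ x : a b / a + b}.
Proof. by move=> a b; apply: linf_ext => i /=; rewrite scalerDl. Qed.

HB.instance Definition _ := GRing.Zmodule_isLmodule.Build R linf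
  linfZA linfZ1 linfZDr linfZDl.

Definition linf_norm (x : linf) : R := sup (range (fun i => `|x i|)).

Lemma le_linf_norm (x : linf) i : `|x i| <= linf_norm x.
Proof.
have [M xM] := linf_bounded x; apply: ub_le_sup; last by exists i.
by exists M => _ [j _ <-].
Qed.

Lemma linf_norm_empty (x : linf) : (I -> False) -> linf_norm x = 0.
Proof.
move=> noI; rewrite /linf_norm (_ : range (fun i => `|x i|) = set0) ?sup0//.
by rewrite -subset0 => y [i _ _]; exact: noI i.
Qed.

(** The hypothesis on [M] accounts for an empty index set, where the norm is
    the supremum of the empty set, namely zero. *)
Lemma linf_norm_le (x : linf) M :
  0 <= M -> (forall i, `|x i| <= M) -> linf_norm x <= M.
Proof.
move=> M0 xM; have [[i _]|noI] := pselect (exists i : I, True).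
  by apply: ge_sup => [|_ [j _ <-]//]; exists `|x i|, i.
by rewrite linf_norm_empty// => i; apply: noI; exists i.
Qed.

Lemma linf_norm_ge0 (x : linf) : 0 <= linf_norm x.
Proof.
have [[i _]|noI] := pselect (exists i : I, True).
  exact: le_trans (normr_ge0 _) (le_linf_norm x i).
by rewrite linf_norm_empty// => i; apply: noI; exists i.
Qed.

Lemma linf_normD x y : linf_norm (x + y) <= linf_norm x + linf_norm y.
Proof.
apply: linf_norm_le => [|i]; first by rewrite addr_ge0 ?linf_norm_ge0.
by rewrite (le_trans (ler_normD _ _))// lerD// le_linf_norm.
Qed.

Lemma linf_norm0_eq0 x : linf_norm x = 0 -> x = 0.
Proof.
move=> x0; apply: linf_ext => i; apply/eqP.
by rewrite -normr_le0 -x0 le_linf_norm.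
Qed.

Lemma linf_normZ (a : R) x : linf_norm (a *: x) = `|a| * linf_norm x.
Proof.
have Zle b y : linf_norm (b *: y) <= `|b| * linf_norm y.
  apply: linf_norm_le => [|i]; first by rewrite mulr_ge0 ?linf_norm_ge0.
  by rewrite normrZ ler_wpM2l ?le_linf_norm.
apply/eqP; rewrite eq_le Zle /=.
have [->|a0] := eqVneq a 0; first by rewrite normr0 mul0r linf_norm_ge0.
(* the reverse inequality is the direct one applied to the inverse scalar *)
rewrite mulrC -ler_pdivlMr ?normr_gt0// mulrC -normfV.
by rewrite -[in leLHS](scalerK a0 x).
Qed.

HB.instance Definition _ := Lmodule_isNormed.Build R linf
  linf_normD linf_normZ linf_norm0_eq0.

Lemma linf_normP (x : linf) M :
  0 <= M -> `|x| <= M <-> forall i, `|x i| <= M.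
Proof.
move=> M0; split=> [xM i|]; last exact: linf_norm_le.
exact: le_trans (le_linf_norm x i) xM.
Qed.

Lemma linfB (x y : linf) i : (x - y) i = x i - y i.
Proof. by []. Qed.

(** The coordinates of a Cauchy filter are Cauchy, hence converge, and the
    family of their limits is the limit: a bound [e] on the distance of two
    members of the filter holds at every coordinate, so it survives passing to
    the limit at each coordinate separately.  The same inequality shows that
    the family of limits is bounded. *)
Lemma linf_cauchy_cvg (F : set_system linf) :
  ProperFilter F -> cauchy F -> cvg F.
Proof.
move=> FF /cauchy_ballP Fc.
have cvF i : cvg ((fun x : linf => x i) @ F).
  apply: cauchy_cvg; apply/cauchy_ballP => e e0.
  rewrite near_simpl; apply: filterS (Fc e e0) => -[x y] /=.
  rewrite -!ball_normE/= -linfB => /(le_lt_trans _); apply.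
  exact: le_linf_norm.
pose l i := lim ((fun x : linf => x i) @ F).
have near_l e : 0 < e ->
    \forall x \near F, forall i, `|l i - linf_coord x i| <= e.
  move=> e0; apply: filterS (nearP_dep (Fc e e0)) => x Fx i.
  have xi : `|y i - x i| @[y --> F] --> `|l i - x i|.
    by apply: cvg_norm; apply: cvgB; [exact: cvF|exact: cvg_cst].
  apply: (cvgr_to_le xi).
  apply: filterS Fx => y; rewrite -ball_normE/= distrC => /ltW.
  by move=> /(le_trans (le_linf_norm _ i)); rewrite linfB.
have l_bounded : exists M, forall i, `|l i| <= M.
  have [x lx] := filter_ex (near_l 1 ltr01).
  have [M xM] := linf_bounded x; exists (1 + M) => i.
  by rewrite -[l i](subrK (x i)) (le_trans (ler_normD _ _))// lerD ?lx ?xM.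
apply/cvg_ex; exists (Linf l_bounded); apply/cvgrPdist_le => e e0.
apply: filterS (near_l e e0) => x lx.
by apply/linf_normP => [|i]; [exact: ltW|rewrite linfB].
Qed.

HB.instance Definition _ := Uniform_isComplete.Build linf linf_cauchy_cvg.

End LinfSum.

(** * The shift on the bilateral sum *)

Section Shift.
Context {R : realType} (X Y : completeNormedModType R).

Definition bilateral_fam (n : int) : completeNormedModType R :=
  match n with Posz _ => Y | Negz _ => X end.

Definition bilateral : completeNormedModType R := linf bilateral_fam.

Implicit Types (z w : bilateral) (f : X -> Y).

Lemma bilateral_ballP z :
  unit_ball bilateral z <-> forall n, unit_ball (bilateral_fam n) (z n).
Proof. exact: linf_normP. Qed.

Section Delta.
Variable x : X.

Definition delta_coord (n : int) : bilateral_fam n :=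
  match n with Posz _ => 0 | Negz 0 => x | Negz _.+1 => 0 end.

Lemma delta_coord_le n : `|delta_coord n| <= `|x|.
Proof. by case: n => [n|[|n]] //=; rewrite normr0. Qed.

(** The isometric copy of [X] at the last index before the crossing. *)
Definition delta : bilateral :=
  Linf (ex_intro _ `|x| delta_coord_le).

Lemma delta_ball : unit_ball X x -> unit_ball bilateral delta.
Proof.
by move=> x1; apply/bilateral_ballP => n; exact: le_trans (delta_coord_le n) x1.
Qed.

End Delta.

Definition shift_coord f z (n : int) : bilateral_fam n :=
  match n with
  | Posz 0 => f (z (Negz 0))
  | Posz n'.+1 => z (Posz n')
  | Negz n' => z (Negz n'.+1)
  end.

Lemma shift_coord_bounded f z : exists M, forall n, `|shift_coord f z n| <= M.
Proof.
have [M zM] := linf_bounded z.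
exists (Num.max `|f (z (Negz 0))| M) => -[[|n]|n] /=; rewrite le_max ?lexx//.
- by rewrite (zM (Posz n)) orbT.
- by rewrite (zM (Negz n.+1)) orbT.
Qed.

Definition shift f z : bilateral := Linf (shift_coord_bounded f z).

Definition unshift_coord (x : X) w (n : int) : bilateral_fam n :=
  match n with
  | Posz n' => w (Posz n'.+1)
  | Negz 0 => x
  | Negz n'.+1 => w (Negz n')
  end.

Lemma unshift_coord_bounded x w :
  exists M, forall n, `|unshift_coord x w n| <= M.
Proof.
have [M wM] := linf_bounded w.
exists (Num.max `|x| M) => -[n|[|n]] /=; rewrite le_max ?lexx//.
- by rewrite (wM (Posz n.+1)) orbT.
- by rewrite (wM (Negz n)) orbT.
Qed.

(** Undoing the shift at the crossing requires a preimage of [w 0] under the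
    crossing map; it is passed as [x], so that no inverse of that map has to
    be named. *)
Definition unshift x w : bilateral := Linf (unshift_coord_bounded x w).

Lemma shift_bij f : set_bij (unit_ball X) (unit_ball Y) f ->
  set_bij (unit_ball bilateral) (unit_ball bilateral) (shift f).
Proof.
case=> f_fun f_inj f_surj; split.
- move=> z /bilateral_ballP z1; apply/bilateral_ballP => -[[|n]|n] /=.
  + exact: f_fun (z1 (Negz 0)).
  + exact: (z1 (Posz n)).
  + exact: (z1 (Negz n.+1)).
- move=> z w; rewrite !inE => /bilateral_ballP z1 /bilateral_ballP w1 zw.
  have shift_eq n : shift_coord f z n = shift_coord f w n.
    by rewrite -[LHS]/(shift f z n) zw.
  apply: linf_ext => -[n|[|n]].
  + exact: (shift_eq (Posz n.+1)).
  + apply: f_inj (shift_eq (Posz 0)); rewrite inE.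
    * exact: (z1 (Negz 0)).
    * exact: (w1 (Negz 0)).
  + exact: (shift_eq (Negz n)).
- move=> w /bilateral_ballP w1.
  have [x x1 fx] := f_surj _ (w1 (Posz 0)).
  exists (unshift x w); last by apply: linf_ext => -[[|n]|n].
  apply/bilateral_ballP => -[n|[|n]] //=.
  + exact: (w1 (Posz n.+1)).
  + exact: (w1 (Negz n)).
Qed.

Lemma shift_nonexpansive f : nonexpansive_on (unit_ball X) f ->
  nonexpansive_on (unit_ball bilateral) (shift f).
Proof.
move=> /nonexpansive_onP f1; apply/nonexpansive_onP => z w.
move=> /bilateral_ballP z1 /bilateral_ballP w1.
have zw n : `|z n - w n| <= `|z - w| by rewrite -linfB; exact: le_linf_norm.
apply/linf_normP => // -[[|n]|n]; rewrite linfB/=.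
- exact: le_trans (f1 _ _ (z1 (Negz 0)) (w1 (Negz 0))) (zw (Negz 0)).
- exact: (zw (Posz n)).
- exact: (zw (Negz n.+1)).
Qed.

Lemma isometry_of_shift f : nonexpansive_on (unit_ball X) f ->
  isometry_on (unit_ball bilateral) (shift f) -> isometry_on (unit_ball X) f.
Proof.
move=> /nonexpansive_onP f1 shift_iso x y x1 y1.
apply/eqP; rewrite eq_le f1//=.
have /le_trans -> // : `|x - y| <= `|delta x - delta y|.
  exact: (le_linf_norm (delta x - delta y) (Negz 0)).
rewrite -shift_iso; [|exact: delta_ball..].
(* both shifted families vanish outside the crossing *)
by apply/linf_normP => // -[[|n]|n]; rewrite linfB//= subrr normr0.
Qed.

End Shift.

Theorem theorem3p1 (R : realType) :
  (exists (X Y : completeNormedModType R) (f : X -> Y),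
     [/\ set_bij (unit_ball X) (unit_ball Y) f,
         nonexpansive_on (unit_ball X) f &
         ~ isometry_on (unit_ball X) f]) ->
  exists (Z : completeNormedModType R) (f' : Z -> Z),
    [/\ set_bij (unit_ball Z) (unit_ball Z) f',
        nonexpansive_on (unit_ball Z) f' &
        ~ isometry_on (unit_ball Z) f'].
Proof.
case=> X [Y] [f] [f_bij f_nonexp f_noniso].
exists (bilateral X Y), (shift f); split; first exact: shift_bij.
- exact: shift_nonexpansive.
- by move=> /(isometry_of_shift f_nonexp).
Qed.
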